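(* Let $\Gamma$ be a countable group acting, without inversion, on a non-trivial tree $\mathcal{T}$. If every vertex stabilizer of $\mathcal{T}$ is infinite and, for every edge $e$ of $\mathcal{T}$, the stabilizer of $e$ is finite and is a highly core-free subgroup of both the stabilizer of the source of $e$ and the stabilizer of the range of $e$, then $\Gamma\in\mathcal{H}_{\mathcal R}$.
   Context: Trees and group actions without inversion on trees are in the sense of Serre's book ''Trees'' (edges are oriented, each edge $e$ having a source, a range and an inverse edge $\overline e\neq e$; without inversion means $ge\neq\overline e$ for all $g\in\Gamma$ and all edges $e$). A tree is non-trivial if it has at least one edge. The Random Graph $\mathcal R$ is the unique (up to isomorphism) countably infinite simple undirected graph such that for all disjoint finite sets $U,W$ of vertices there is a vertex $z\notin U\cup W$ adjacent to every vertex of $U$ and to no vertex of $W$. An action of a group $\Gamma$ on $\mathcal R$ is a homomorphism $\Gamma\to\mathrm{Aut}(\mathcal R)$. It is homogeneous if for every graph isomorphism $\varphi:U\to W$ between finite induced subgraphs of $\mathcal R$ there is $g\in\Gamma$ with $g u=\varphi(u)$ for all $u\in U$. $\mathcal H_{\mathcal R}$ denotes the class of all countable groups admitting a faithful and homogeneous action on $\mathcal R$. For a subgroup $\Sigma<\Gamma$ and a non-empty subset $S\subset\Gamma$, put $\mathrm{Core}_S(\Sigma)=\bigcap_{h\in S}h^{-1}\Sigma h$. The subgroup $\Sigma$ is highly core-free in $\Gamma$ if for every finite subset $F\subset\Gamma$, every $n\geq 1$ and all non-empty subsets $S_1,\dots,S_n\subset\Gamma$ with $\Gamma\setminus\Sigma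 F\subset\bigcup_{k=1}^n S_k$, there is $k\in\{1,\dots,n\}$ with $\mathrm{Core}_{S_k}(\Sigma)=\{1\}$. *)

(* Defs.v *)
From mathcomp Require Import all_boot.
From mathcomp Require Import boolp classical_sets functions cardinality.

Set Implicit Arguments.
Unset Strict Implicit.
Unset Printing Implicit Defensive.

Local Open Scope group_scope.
Local Open Scope classical_set_scope.

(* Graphs in the sense of Serre. *)
Record graph := Graph {
  vertex : eqType;
  edge : eqType;
  src : edge -> vertex;
  rng : edge -> vertex;
  bar : edge -> edge;
  barK : forall e, bar (bar e) = e;
  bar_neq : forall e, bar e <> e;
  src_bar : forall e, src (bar e) = rng e }.

Fixpoint is_walk (T : graph) (x : vertex T) (p : seq (edge T)) (y : vertex T) :
    Prop :=
  if p is e :: q then src e = x /\ is_walk (rng e) q y else x = y.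

(* Serre's circuits: closed paths of positive length, without backtracking,
   whose successive end points are pairwise distinct. Loops are circuits of
   length 1 and pairs of parallel edges give circuits of length 2. *)
Definition is_circuit (T : graph) (p : seq (edge T)) : Prop :=
  [/\ p <> [::],
      exists x, is_walk x p x,
      sorted (fun e f => f != bar e) p
    & uniq [seq rng e | e <- p]].

Definition is_tree (T : graph) : Prop :=
  [/\ inhabited (vertex T),
      forall x y : vertex T, exists p, is_walk x p y
    & forall p : seq (edge T), ~ is_circuit p].

Definition nontrivial_tree (T : graph) : Prop :=
  is_tree T /\ inhabited (edge T).

Definition is_action (Gamma : groupType) (X : Type) (a : Gamma -> X -> X) :
    Prop :=
  (forall x, a 1 x = x) /\ (forall g h x, a (g * h) x = a g (a h x)).

Definition stabilizer (Gamma : groupType) (X : Type) (a : Gamma -> X -> X)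
  (x : X) : set Gamma := [set g | a g x = x].

Record graph_action (Gamma : groupType) (T : graph) := GraphAction {
  vact : Gamma -> vertex T -> vertex T;
  eact : Gamma -> edge T -> edge T;
  vactP : is_action vact;
  eactP : is_action eact;
  src_eact : forall g e, src (eact g e) = vact g (src e);
  rng_eact : forall g e, rng (eact g e) = vact g (rng e);
  bar_eact : forall g e, bar (eact g e) = eact g (bar e) }.

Definition without_inversion (Gamma : groupType) (T : graph)
    (a : graph_action Gamma T) : Prop :=
  forall g e, eact a g e <> bar e.

Definition vstab (Gamma : groupType) (T : graph) (a : graph_action Gamma T)
  (v : vertex T) : set Gamma := stabilizer (vact a) v.

Definition estab (Gamma : groupType) (T : graph) (a : graph_action Gamma T)
  (e : edge T) : set Gamma := stabilizer (eact a) e.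

(* Recall that [x ^ h] is [h^-1 * x * h]. *)
Definition Core (Gamma : groupType) (S Sigma : set Gamma) : set Gamma :=
  \bigcap_(h in S) [set x ^ h | x in Sigma].

Definition is_subgroup (Gamma : groupType) (H : set Gamma) : Prop :=
  [/\ H 1, forall x y, H x -> H y -> H (x * y) & forall x, H x -> H x^-1].

(* [Sigma] is a highly core-free subgroup of [G], where [G] is itself a
   subgroup of the ambient group [Gamma]: every set involved lies in [G]. *)
Definition highly_core_free (Gamma : groupType) (Sigma G : set Gamma) : Prop :=
  [/\ is_subgroup Sigma, Sigma `<=` G
    & forall F : set Gamma, finite_set F -> F `<=` G ->
      forall (n : nat) (S : 'I_n -> set Gamma), (1 <= n)%N ->
        (forall k, S k !=set0 /\ S k `<=` G) ->
        G `\` [set s * f | s in Sigma & f in F] `<=` \bigcup_k S k ->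
        exists k, Core (S k) Sigma = [set 1]].

Record sgraph := SGraph {
  svertex : Type;
  adj : svertex -> svertex -> Prop;
  adj_sym : forall x y, adj x y -> adj y x;
  adj_irr : forall x, ~ adj x x }.

Definition is_random_graph (R : sgraph) : Prop :=
  ([set: svertex R] #= [set: nat])%card /\
  (forall U W : set (svertex R), finite_set U -> finite_set W ->
     U `&` W = set0 ->
     exists z, [/\ ~ (U `|` W) z,
                   forall u, U u -> adj z u
                 & forall w, W w -> ~ adj z w]).

Definition is_sgraph_action (Gamma : groupType) (R : sgraph)
    (a : Gamma -> svertex R -> svertex R) : Prop :=
  is_action a /\ (forall g x y, adj (a g x) (a g y) <-> adj x y).

Definition faithful (Gamma : groupType) (X : Type) (a : Gamma -> X -> X) :
    Prop :=
  forall g, (forall x, a g x = x) -> g = 1.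

(* An isomorphism between induced subgraphs on [U] and [W] is encoded by a
   total map, of which only the restriction to [U] matters. *)
Definition homogeneous (Gamma : groupType) (R : sgraph)
    (a : Gamma -> svertex R -> svertex R) : Prop :=
  forall (U W : set (svertex R)) (phi : svertex R -> svertex R),
    finite_set U -> finite_set W -> set_bij U W phi ->
    (forall x y, U x -> U y -> (adj (phi x) (phi y) <-> adj x y)) ->
    exists g, forall u, U u -> a g u = phi u.

(* The Random Graph is unique up to isomorphism, and admitting a faithful
   homogeneous action is invariant under isomorphism, so [R] may be any model
   of it. *)
Definition in_HR (Gamma : groupType) : Prop :=
  countable [set: Gamma] /\
  exists (R : sgraph) (a : Gamma -> svertex R -> svertex R),
    [/\ is_random_graph R, is_sgraph_action a, faithful a & homogeneous a].

(* Main.v *)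
Require Import Defs.
From mathcomp Require Import all_boot.
From mathcomp Require Import boolp classical_sets functions cardinality.

(** Fix one edge [e] of the tree, with stabilizer [S], and let [A] and [B] be the
    stabilizers of its source and range. Starting from a free action of [Gamma] on
    the random graph and an automorphism [w] commuting with [S], one obtains a new
    action by inserting [g w g^-1] each time the path from [src e] to its image
    crosses a translate [g e]; the absence of circuits makes this a cocycle. The
    new action is the old one on [A] and is conjugated by [w] on [B].

    A generic [w], built from finite partial isomorphisms, makes it faithful and
    homogeneous. Given a finite partial isomorphism [u_i -> v_i], freeness and
    high core-freeness give [a], [a'] in [A] putting the [a u_i] and the [a' v_i]
    in general position with respect to [S]; choosing [b] in [B] outside [S] and a
    copy [q_i] of the [u_i] in new orbits, one may require [w q_i = a u_i] and
    [w (b q_i) = a' v_i], so that [a'^-1 b a] maps [u_i] to [v_i]. For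
    faithfulness, [w] fixes arbitrary finite subsets of some free orbits. *)

Set Implicit Arguments.
Unset Strict Implicit.
Unset Printing Implicit Defensive.

Local Open Scope group_scope.

(** * Enumerations and generic sequences *)

Definition enumerable (T : Type) : Prop :=
  exists e : nat -> T, forall x, exists n, e n = x.

Lemma enumerable_countable (T : Type) (x0 : T) :
  countable [set: T]%classic -> enumerable T.
Proof.
move=> /countable_injP[f finj].
exists (fun n => if pselect (exists x, f x = n) is left H
                 then projT1 (cid H) else x0) => x.
exists (f x); case: pselect => [H|[]]; last by exists x.
by apply: finj; rewrite ?inE //; exact: projT2 (cid H).
Qed.

Lemma enumerable_seq (T : Type) : enumerable T -> enumerable (seq T).
Proof.
move=> [e eP]; exists (fun n => map e (odflt [::] (unpickle n))) => s.
suff [t <-] : exists t, map e t = s by exists (pickle t); rewrite pickleK.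
elim: s => [|x s [t <-]]; first by exists [::].
by have [n <-] := eP x; exists (n :: t).
Qed.

Lemma enumerable_prod (T U : Type) :
  enumerable T -> enumerable U -> enumerable (T * U).
Proof.
move=> [e eP] [f fP].
exists (fun n => let ij := odflt (0, 0) (unpickle n) in (e ij.1, f ij.2)).
move=> [x y]; have [i <-] := eP x; have [j <-] := fP y.
by exists (pickle (i, j)); rewrite pickleK.
Qed.

Lemma enumerable_nat : enumerable nat.
Proof. by exists id => n; exists n. Qed.

(** A Rasiowa-Sikorski argument: with countably many dense requirements, the [n]-th one is met at
    step [n]. The hypothesis [ok] sits inside the chosen function, so that the recursion runs over
    all of [C]. *)
Lemma generic_sequence (C : Type) (ok : C -> Prop) (le : C -> C -> Prop)
    (D : nat -> C -> Prop) (c0 : C) :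
  ok c0 -> (forall n c, ok c -> exists c', [/\ ok c', le c c' & D n c']) ->
  exists s : nat -> C,
    forall n, [/\ ok (s n), le (s n) (s n.+1) & D n (s n.+1)].
Proof.
move=> ok0 dense.
have /choice[f fP] : forall nc : nat * C, exists c',
    ok nc.2 -> [/\ ok c', le nc.2 c' & D nc.1 c'].
  move=> [n c]; have [okc|nokc] := pselect (ok c); last by exists c.
  by have [c' c'P] := dense n c okc; exists c'.
pose s := fix s n := if n is m.+1 then f (m, s m) else c0.
have oks n : ok (s n) by elim: n => //= n /(fP (n, s n))[].
by exists s => n; have [? ? ?] := fP (n, s n) (oks n); split.
Qed.

(** * Rich free actions on graphs *)

(** In [ra_extension] the point [z] avoids the whole orbits of the points of [F], and its neighbours
    in these orbits are exactly those listed in [U]; taking [g] arbitrary controls all translates at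
    once. *)
Record rich_action (Gamma : groupType) (X : eqType) (act : Gamma -> X -> X)
    (adj : rel X) : Prop := RichAction {
  ra_act : is_action act;
  ra_sym : symmetric adj;
  ra_adj : forall g x y, adj (act g x) (act g y) = adj x y;
  ra_free : forall g x, act g x = x -> g = 1;
  ra_orbit : forall g x, ~~ adj x (act g x);
  ra_proper : forall x y, exists s : seq Gamma,
    forall k, adj x (act k y) -> k \in s;
  ra_extension : forall U F : seq X, exists z, forall f g, f \in F ->
    z != act g f /\ adj z (act g f) = (act g f \in U) }.

(* The orbit [n] is attached to the previous ones by joining [(1, n)] to the
   points of [E n]; each finite set occurs as [E n] for arbitrarily large [n]. *)
Section Model.
Variables (Gamma : groupType) (E : nat -> seq (Gamma * nat)).
Hypothesis E_onto : forall U m, exists2 n, (m <= n)%N & E n = U.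

Definition model_act (g : Gamma) (x : Gamma * nat) := (g * x.1, x.2).

Definition model_down (x y : Gamma * nat) :=
  (y.2 < x.2)%N && ((x.1^-1 * y.1, y.2) \in E x.2).

Definition model_adj (x y : Gamma * nat) := model_down x y || model_down y x.

Lemma model_rich : rich_action model_act model_adj.
Proof.
have downE g x y :
    model_down (model_act g x) (model_act g y) = model_down x y.
  by rewrite /model_down /model_act /= invgM -mulgA mulKg.
have proper x y : exists s : seq Gamma, forall k,
    model_down x (model_act k y) -> k \in s.
  exists [seq x.1 * z.1 * y.1^-1 | z <- E x.2] => k /andP[_ /= kE].
  by apply/mapP; exists (x.1^-1 * (k * y.1), y.2); rewrite //= mulVKg mulgK.
have actM g h x : model_act (g * h) x = model_act g (model_act h x).
  by rewrite /model_act mulgA.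
have act1 x : model_act 1 x = x by case: x => g n; rewrite /model_act mul1g.
split=> //.
- by move=> x y; rewrite /model_adj orbC.
- by move=> g x y; rewrite /model_adj !downE.
- by move=> g [h n] [gh]; apply: (mulIg h); rewrite gh mul1g.
- by move=> g x; rewrite /model_adj /model_down /= ltnn.
- move=> x y; have [s sP] := proper x y; have [t tP] := proper y x.
  exists (s ++ [seq k^-1 | k <- t]) => k; rewrite mem_cat.
  case/orP => [/sP->//|]; rewrite -(downE k^-1) -actM mulVg act1 => /tP kt.
  by apply/orP; right; apply/mapP; exists k^-1; rewrite ?invgK.
- move=> U F.
  (* The orbit [n] comes after every orbit meeting [F], so adjacency of [(1, n)] to these orbits is
     decided by [E n] alone. *)
  have [n Fn EU] := E_onto U (\max_(f <- F) f.2.+1); exists (1, n) => f g fF.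
  have fn : (f.2 < n)%N by apply: leq_trans Fn; apply: leq_bigmax_seq.
  split.
    by apply/eqP => -[_ nf]; rewrite nf ltnn in fn.
  rewrite /model_adj /model_down /= fn (ltnNge n) (ltnW fn) orbF.
  by rewrite invg1 mul1g EU.
Qed.

End Model.

Lemma ex_rich_action (Gamma : groupType) : countable [set: Gamma]%classic ->
  exists adj, rich_action (@model_act Gamma) adj.
Proof.
move=> /(enumerable_countable 1) enumG.
have [e eP] := enumerable_seq (enumerable_prod enumG enumerable_nat).
exists (model_adj (fun n => e (logn 2 n))); apply: model_rich => U m.
(* The second factor is odd, so the 2-adic valuation is [k], while [m] makes the number as large as
   required. *)
have [k <-] := eP U; exists (2 ^ k * (m.*2.+1))%N.
  apply: (@leq_trans (1 * m.*2.+1)); last by rewrite leq_mul2r expn_gt0 orbT.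
  by rewrite mul1n -addnn ltnW // ltnS leq_addr.
rewrite lognM ?expn_gt0 // pfactorK // logn_coprime ?addn0 //.
by rewrite coprime2n /= odd_double.
Qed.

(** The form in which high core-freeness is used: some [a], outside a given finite set, conjugates
    finitely many nontrivial elements out of [S]. *)
Definition subgroup_escapes (Gamma : groupType) (S A : set Gamma) : Prop :=
  forall ts s : seq Gamma, 1 \notin ts ->
    exists2 a, A a & a \notin s /\ forall t, t \in ts -> ~ S (a * t * a^-1).

Lemma infinite_escapes (Gamma : groupType) (A : set Gamma) (s : seq Gamma) :
  infinite_set A -> exists2 a, A a & a \notin s.
Proof.
move=> Ainf; apply: contrapT => noA; apply: Ainf.
apply: (@sub_finite_set _ _ [set` s]%classic); last by apply/finite_seqP; exists s.
by move=> a Aa /=; apply/negP => /negP sa; apply: noA; exists a.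
Qed.

(* The set [S_t] of the [h] in [A] with [h t h^-1] in [S] has [t] in its core, so
   the sets [S_t], for finitely many [t <> 1], cannot cover [A] up to a finite set. *)
Lemma hcf_escapes (Gamma : groupType) (S A : set Gamma) :
  infinite_set A -> highly_core_free S A -> subgroup_escapes S A.
Proof.
move=> Ainf [[S1 _ _] _ hcf] ts s ts1.
pose St t : set Gamma := [set h | A h /\ S (h * t * h^-1)]%classic.
(* The sets in the definition of high core-freeness must be non-empty, so only the [t] with [St t]
   inhabited are kept. *)
pose us := [seq t <- ts | `[< exists h, St t h >]].
apply: contrapT => noA.
have cover a : A a -> a \notin s -> exists2 t, t \in us & St t a.
  move=> Aa sa; apply: contrapT => nou; apply: noA; exists a => //; split=> //.
  move=> t tts Sa; apply: nou; exists t; last by split.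
  by rewrite mem_filter tts andbT; apply/asboolP; exists a.
have [a0 Aa0 a0s] := infinite_escapes s Ainf.
have us_gt0 : (0 < size us)%N.
  by have [t tus _] := cover _ Aa0 a0s; rewrite -has_predT; apply/hasP; exists t.
pose F := ([set` s] `&` A)%classic.
have [||k|g|k coreE] := hcf F _ _ (size us) (fun k => St (nth 1 us k)) us_gt0.
- by apply: (@sub_finite_set _ _ [set` s]%classic);
    [move=> x [] | apply/finite_seqP; exists s].
- by move=> x [].
- split; last by move=> h [].
  have := mem_nth 1 (ltn_ord k); rewrite mem_filter => /andP[/asboolP[h hP] _].
  by exists h.
- move=> [Ag SFg]; have [|t tus Stg] := cover g Ag.
    apply/negP => gs; apply: SFg; exists 1 => //; exists g => //.
    by rewrite mul1g.
  have ti : (index t us < size us)%N by rewrite index_mem.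
  by exists (Ordinal ti) => //=; rewrite nth_index.
- have := mem_nth 1 (ltn_ord k); rewrite mem_filter => /andP[_ tts].
  have : Core (St (nth 1 us k)) S (nth 1 us k).
    move=> h [_ Sh]; exists (h * nth 1 us k * h^-1) => //.
    by rewrite conjgE !mulgA mulVg mul1g mulgVK.
  by rewrite coreE => /= t1; rewrite t1 (negbTE ts1) in tts.
Qed.

(** * Finite partial equivariant isomorphisms *)

Section Conditions.
Variables (Gamma : groupType) (X : eqType) (act : Gamma -> X -> X) (adj : rel X).
Hypothesis rich : rich_action act adj.
Variables (S A B : set Gamma).
Hypotheses (S_subgroup : is_subgroup S) (S_finite : finite_set S).
Hypothesis A_escapes : subgroup_escapes S A.
Hypothesis B_infinite : infinite_set B.

Let act1 x : act 1 x = x.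
Proof. by have [[]] := rich. Qed.
Let actM g h x : act (g * h) x = act g (act h x).
Proof. by have [[]] := rich. Qed.
Let adjC x y : adj x y = adj y x.
Proof. exact: (ra_sym rich). Qed.
Let actK g : cancel (act g) (act g^-1).
Proof. by move=> x; rewrite -actM mulVg act1. Qed.
Let actVK g : cancel (act g^-1) (act g).
Proof. by move=> x; rewrite -actM mulgV act1. Qed.
Let S1 : S 1. Proof. by case: S_subgroup. Qed.
Let SM x y : S x -> S y -> S (x * y).
Proof. by have [_ + _] := S_subgroup; apply. Qed.
Let SV x : S x -> S x^-1.
Proof. by have [_ _] := S_subgroup; apply. Qed.

Let adjxx x : adj x x = false.
Proof. by have := ra_orbit rich 1 x; rewrite act1 => /negbTE. Qed.

Let act_eq g x y : (act g x == act g y) = (x == y).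
Proof. exact: (inj_eq (can_inj (actK g))). Qed.

Let act_free g x : (x == act g x) = (g == 1).
Proof.
by apply/eqP/eqP => [/esym /(ra_free rich)//|->]; rewrite act1.
Qed.

(** Two pairs whose entries are not near each other, on both sides and up to [S], put no constraint
    on each other. *)
Definition near (x y : X) := (x == y) || adj x y.

Lemma near_sym x y : near x y = near y x.
Proof. by rewrite /near adjC eq_sym. Qed.

Lemma near_act g x y : near (act g x) (act g y) = near x y.
Proof. by rewrite /near (ra_adj rich) act_eq. Qed.

Lemma near_actV g x y : near (act g x) y = near x (act g^-1 y).
Proof. by rewrite -{1}(actVK g y) near_act. Qed.

(** Properness bounds the translates giving adjacency, and freeness leaves at most one giving
    equality. *)
Lemma near_proper (U V : seq X) : exists s : seq Gamma,
  forall x y k, x \in U -> y \in V -> near x (act k y) -> k \in s.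
Proof.
have near1 x y : exists s : seq Gamma, forall k, near x (act k y) -> k \in s.
  have [s sP] := ra_proper rich x y.
  have [[k0 xk0]|nok] := pselect (exists k, x = act k y).
    exists (k0 :: s) => k; rewrite inE; case/orP => [/eqP xk|/sP-> //]; last first.
      by rewrite orbT.
    have : y == act (k0^-1 * k) y by rewrite actM -xk xk0 actK.
    by rewrite act_free mulg_eq1 => /eqP/invg_inj->; rewrite eqxx.
  exists s => k /orP[/eqP xk|/sP//].
  by case: nok; exists k.
have near2 x : exists s : seq Gamma,
    forall y k, y \in V -> near x (act k y) -> k \in s.
  elim: V => [|y V [s sP]]; first by exists [::].
  have [t tP] := near1 x y; exists (t ++ s) => y' k; rewrite mem_cat inE.
  by case/orP => [/eqP-> /tP->//|y'V /(sP _ _ y'V)->]; rewrite orbT.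
elim: U => [|x U [s sP]]; first by exists [::].
have [t tP] := near2 x; exists (t ++ s) => x' y k; rewrite mem_cat inE.
case/orP => [/eqP-> yV /(tP _ _ yV)->//|x'U yV /(sP _ _ _ x'U yV)->].
by rewrite orbT.
Qed.

Lemma S_seq : exists sS : seq Gamma, forall g, S g <-> g \in sS.
Proof.
by have /finite_seqP[sS ->] := S_finite; exists sS.
Qed.

(* A finite list [c] of pairs stands for the partial map sending [act s p.1] to
   [act s p.2], for [p] in [c] and [s] in [S]. *)
Definition compat (p q : X * X) := forall s, S s ->
  (p.1 == act s q.1) = (p.2 == act s q.2) /\
  adj p.1 (act s q.1) = adj p.2 (act s q.2).

Definition condition (c : seq (X * X)) :=
  forall p q, p \in c -> q \in c -> compat p q.

Definition maps (c : seq (X * X)) (x y : X) :=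
  exists2 p, p \in c & exists2 s, S s & x = act s p.1 /\ y = act s p.2.

Definition swap (p : X * X) := (p.2, p.1).

Lemma compat_sym p q : compat p q -> compat q p.
Proof.
move=> pq s /SV/pq[eqpq adjpq].
have eqV x y : (x == act s y) = (y == act s^-1 x).
  by rewrite -(act_eq s^-1) actK eq_sym.
have adjV x y : adj x (act s y) = adj y (act s^-1 x).
  by rewrite -(ra_adj rich s^-1) actK adjC.
by rewrite !eqV !adjV.
Qed.

(** By freeness both equalities say [s = 1], and no orbit contains adjacent points. *)
Lemma compat_refl p : compat p p.
Proof.
move=> s _; rewrite !act_free; split=> //.
by rewrite !(negbTE (ra_orbit rich _ _)).
Qed.

Lemma compat_far1 p q :
  (p.1 == q.1) = (p.2 == q.2) /\ adj p.1 q.1 = adj p.2 q.2 ->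
  (forall s, S s -> s != 1 ->
     ~~ near p.1 (act s q.1) /\ ~~ near p.2 (act s q.2)) ->
  compat p q.
Proof.
move=> pq far s Ss; have [->|s1] := eqVneq s 1; first by rewrite !act1.
have [] := far s Ss s1; rewrite !negb_or.
by move=> /andP[/negbTE-> /negbTE->] /andP[/negbTE-> /negbTE->].
Qed.

Lemma compat_far p q :
  (forall s, S s -> ~~ near p.1 (act s q.1) /\ ~~ near p.2 (act s q.2)) ->
  compat p q.
Proof.
move=> far; apply: compat_far1 => [|s Ss _]; last exact: far.
have := far 1 S1; rewrite !act1 !negb_or.
by case=> /andP[/negbTE-> /negbTE->] /andP[/negbTE-> /negbTE->].
Qed.

Lemma compat_swap p q : compat p q -> compat (swap p) (swap q).
Proof. by move=> pq s /pq[]. Qed.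

Lemma condition_swap c : condition c -> condition (map swap c).
Proof.
move=> okc _ _ /mapP[p pc ->] /mapP[q qc ->].
by apply: compat_swap; apply: okc.
Qed.

Lemma condition_cat c d : condition c -> condition d ->
  (forall p q, p \in c -> q \in d -> compat p q) -> condition (c ++ d).
Proof.
move=> okc okd cd p q; rewrite !mem_cat => /orP[pc|pd] /orP[qc|qd].
- exact: okc.
- exact: cd.
- exact/compat_sym/cd.
- exact: okd.
Qed.

Lemma maps_sub c d x y : {subset c <= d} -> maps c x y -> maps d x y.
Proof. by move=> cd [p /cd pd sP]; exists p. Qed.

Lemma maps_mem c p : p \in c -> maps c p.1 p.2.
Proof. by move=> pc; exists p => //; exists 1; rewrite ?act1. Qed.

Lemma maps_act c s x y : S s -> maps c x y -> maps c (act s x) (act s y).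
Proof.
move=> Ss [p pc [t St [-> ->]]]; exists p => //; exists (s * t); last first.
  by rewrite !actM.
exact: SM.
Qed.

(** Applying the inverse of one translating element reduces to [compat]. Hence [maps c] is a
    single-valued, injective partial map preserving adjacency and non-adjacency. *)
Lemma maps_compat c x y x' y' : condition c -> maps c x y -> maps c x' y' ->
  (x == x') = (y == y') /\ adj x x' = adj y y'.
Proof.
move=> okc [p pc [s Ss [-> ->]]] [q qc [t St [-> ->]]].
have eqS x1 y1 : (act s x1 == act t y1) = (x1 == act (s^-1 * t) y1).
  by rewrite -(act_eq s^-1) actK actM.
have adjS x1 y1 : adj (act s x1) (act t y1) = adj x1 (act (s^-1 * t) y1).
  by rewrite -(ra_adj rich s^-1) actK actM.
by rewrite !eqS !adjS; apply: okc => //; apply: SM (SV Ss) St.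
Qed.

Lemma maps_swap c x y : maps (map swap c) x y -> maps c y x.
Proof.
by move=> [_ /mapP[p pc ->] [s Ss [-> ->]]]; exists p => //; exists s.
Qed.

Lemma dense_dom c x : condition c -> exists c',
  [/\ condition c', {subset c <= c'} & exists y, maps c' x y].
Proof.
move=> okc; have [xdom|xdom] := pselect (exists y, maps c x y).
  by exists c; split.
have [sS sSP] := S_seq.
(* [V] lists the images of the neighbours of [x] in the domain; the new value [z] is to be adjacent
   to exactly these among the translates of old values. *)
pose V := [seq act sq.1 sq.2.2 |
  sq <- [seq sq <- [seq (s, q) | s <- sS, q <- c] | adj x (act sq.1 sq.2.1)]].
have [z zP] := ra_extension rich V (map snd c).
exists ((x, z) :: c); split; last 2 first.
- by move=> p pc; rewrite inE pc orbT.
- by exists z; apply: (@maps_mem _ (x, z)); rewrite mem_head.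
apply: (@condition_cat [:: (x, z)]) => //.
  by move=> p q; rewrite !inE => /eqP-> /eqP->; apply: compat_refl.
move=> p q; rewrite inE => /eqP-> qc s Ss /=.
have [/negbTE-> ->] := zP q.2 s (map_f snd qc); split.
  apply/negbTE/eqP => xq; apply: xdom; exists (act s q.2).
  by exists q => //; exists s.
have inV t r : S t -> r \in c -> adj x (act t r.1) -> act t r.2 \in V.
  move=> St rc xr; apply/mapP; exists (t, r) => //.
  by rewrite mem_filter xr; apply: allpairs_f => //; apply/sSP.
apply/idP/idP => [|/mapP[[t r]]]; first exact: inV.
rewrite mem_filter /= => /andP[xr /allpairsP[[t' r'] /= [/sSP St rc [tt rr]]]].
rewrite {}tt {}rr in xr * => qr.
(* Injectivity of the partial map identifies the two preimages, so adjacency of [x] to one is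
   adjacency to the other. *)
have m1 : maps c (act s q.1) (act s q.2) by apply/maps_act/maps_mem.
have m2 : maps c (act t' r'.1) (act t' r'.2) by apply/maps_act/maps_mem.
by have [] := maps_compat okc m1 m2; rewrite qr eqxx => /eqP->.
Qed.

Lemma dense_cod c y : condition c -> exists c',
  [/\ condition c', {subset c <= c'} & exists x, maps c' x y].
Proof.
have swapK : involutive swap by case.
move=> /condition_swap okc; have [c' [okc' sub [x xy]]] := dense_dom y okc.
exists (map swap c'); split; first exact: condition_swap.
  by move=> p pc; rewrite -(swapK p); apply/map_f/sub/map_f.
exists x; apply: maps_swap; rewrite -map_comp.
by rewrite (eq_map (_ : swap \o swap =1 id)) ?map_id //.
Qed.

Lemma dense_fix c (K : seq Gamma) : condition c -> exists c',
  [/\ condition c', {subset c <= c'}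
    & exists z, forall k, k \in K -> maps c' (act k z) (act k z)].
Proof.
move=> okc; have [z zP] := ra_extension rich [::] (map fst c ++ map snd c).
have far k f : f \in map fst c ++ map snd c -> forall s, ~~ near (act k z) (act s f).
  move=> fc s; rewrite near_actV -actM.
  by have [zf zfA] := zP f (k^-1 * s) fc; rewrite /near (negbTE zf) zfA.
exists ([seq (act k z, act k z) | k <- K] ++ c); split; last 2 first.
- by move=> p pc; rewrite mem_cat pc orbT.
- exists z => k kK; apply: (@maps_mem _ (act k z, act k z)).
  by rewrite mem_cat (map_f (fun k => (act k z, act k z)) kK).
apply: condition_cat => //.
  by move=> _ _ /mapP[k _ ->] /mapP[l _ ->] s _.
move=> _ q /mapP[k _ ->] qc; apply: compat_far => s _ /=.
by split; apply: far; rewrite mem_cat (map_f _ qc) ?orbT.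
Qed.

(** Points are added one at a time, each in a new orbit and joined only to the copies [Q v] of its
    neighbours, never to their other translates. *)
Lemma fresh_copy (us F : seq X) : exists Q : X -> X,
  (forall u u' k, u \in us -> u' \in us ->
     (Q u == act k (Q u')) = (u == u') && (k == 1) /\
     adj (Q u) (act k (Q u')) = adj u u' && (k == 1)) /\
  (forall u f k, u \in us -> f \in F -> ~~ near (Q u) (act k f)).
Proof.
elim: us => [|u us [Q [QP QF]]]; first by exists id.
have [uus|uus] := boolP (u \in us).
  have sub v : v \in u :: us -> v \in us by rewrite inE => /predU1P[->|].
  exists Q; split=> [v v' k /sub vus /sub v'us|v f k /sub vus]; first exact: QP.
  exact: QF.
have [z zP] := ra_extension rich [seq Q v | v <- us & adj u v] (F ++ map Q us).
have zQ v k : v \in us ->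
    (z == act k (Q v)) = false /\ adj z (act k (Q v)) = adj u v && (k == 1).
  move=> vus; have [|/negbTE-> ->] := zP (Q v) k.
    by rewrite mem_cat map_f ?orbT.
  split=> //; apply/mapP/andP => [[v']|[uv /eqP->]]; last first.
    by exists v; rewrite ?act1 // mem_filter uv.
  rewrite mem_filter => /andP[uv' v'us] /esym/eqP.
  by have [-> _] := QP v' v k v'us vus => /andP[/eqP<-].
have uP v : v \in us -> (v == u) = false.
  by move=> vus; apply/eqP => vu; rewrite -vu vus in uus.
exists (fun x => if x == u then z else Q x); split=> [v v' k|v f k].
  rewrite !inE => /predU1P[->|vus] /predU1P[->|v'us].
  - rewrite !eqxx adjxx act_free; split=> //.
    exact/negbTE/(ra_orbit rich).
  - rewrite eqxx uP // [u == _]eq_sym uP //.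
    by have [-> ->] := zQ _ k v'us.
  - rewrite eqxx uP //; have [zv zvA] := zQ _ k^-1 vus; split.
      by rewrite /= -(act_eq k^-1) actK eq_sym zv.
    rewrite -(ra_adj rich k^-1) actK adjC zvA adjC.
    by rewrite -[X in _ && (X == _)]mulg1 mulg_eq1 eqg_inv eq_sym.
  - by rewrite !uP //; apply: QP.
rewrite inE => /predU1P[->|vus] fF; last by rewrite uP //; apply: QF.
rewrite eqxx /near.
have [|/negbTE zf ->] := zP f k; first by rewrite mem_cat fF.
rewrite zf /=; apply/mapP => -[v1]; rewrite mem_filter => /andP[_ v1us] fE.
have := QF v1 f k v1us fF.
by rewrite fE /near eqxx.
Qed.

(** A bad [a] has [a^-1 * s] in a finite set, which excludes finitely many [a], or has a nontrivial
    [a^-1 * s * a] in a finite set, which [A_escapes] prevents. *)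
Lemma generic_translate (U N : seq X) : exists2 a, A a &
  (forall u x s, S s -> u \in U -> x \in N -> ~~ near (act a u) (act s x)) /\
  (forall u u' s, S s -> s != 1 -> u \in U -> u' \in U ->
     ~~ near (act a u) (act s (act a u'))).
Proof.
have [sS sSP] := S_seq.
have [s1 s1P] := near_proper U N; have [s2 s2P] := near_proper U U.
have [|a Aa [as1 aS]] :=
    A_escapes (ts := [seq t <- s2 | t != 1]) [seq s * k^-1 | s <- sS, k <- s1].
  by rewrite mem_filter eqxx.
exists a => //; split=> [u x s Ss uU xN|u u' s Ss s1' uU u'U]; apply/negP;
  rewrite near_actV -!actM.
- move=> /(s1P _ _ _ uU xN) as1'; move/negP: as1; apply.
  apply/allpairsP; exists (s, a^-1 * s); split=> //=; first exact/sSP.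
  by rewrite invgM invgK mulVKg.
- rewrite -mulgA => /(s2P _ _ _ uU u'U) ts2; apply: (aS (a^-1 * (s * a))).
    by rewrite mem_filter ts2 -conjgE conjg_eq1 s1'.
  by rewrite mulVKg mulgK.
Qed.

Definition partial_iso (L : seq (X * X)) :=
  forall p q, p \in L -> q \in L ->
    (p.1 == q.1) = (p.2 == q.2) /\ adj p.1 q.1 = adj p.2 q.2.

(** If [w] extends [c], then [w b w^-1] sends [act a p.1] to [act a' p.2], for every [p] in [L]. *)
Definition realizes (c L : seq (X * X)) :=
  exists a a' b, [/\ A a, A a', B b & forall p, p \in L ->
    exists q, maps c q (act a p.1) /\ maps c (act b q) (act a' p.2)].

(* The new values [Q u], and their translates by [b], are attached to [act a u]
   and [act a' v]: since [b] is not in [S] these constraints never interfere. *)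
Lemma dense_realizes c L : condition c -> partial_iso L -> exists c',
  [/\ condition c', {subset c <= c'} & realizes c' L].
Proof.
move=> okc isoL.
have [a Aa [aN aS]] := generic_translate (map fst L) (map snd c).
(* The second translate must also avoid the values [act a p.1] just introduced. *)
have [a' Aa' [a'N a'S]] :=
  generic_translate (map snd L) (map snd c ++ map (act a) (map fst L)).
have [sS sSP] := S_seq.
have [b Bb bS] := infinite_escapes sS B_infinite.
have {bS} Sb s : S s -> s * b != 1.
  move=> Ss; apply: contraNneq bS => /mulg1_eq <-; apply/sSP/SV; exact: Ss.
have [Q [QP QF]] := fresh_copy (map fst L) (map fst c).
pose c1 := [seq (Q p.1, act a p.1) | p <- L].
pose c2 := [seq (act b (Q p.1), act a' p.2) | p <- L].
have QS u u' k : u \in map fst L -> u' \in map fst L -> k != 1 ->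
    ~~ near (Q u) (act k (Q u')).
  move=> uL u'L /negbTE k1; have [equ adju] := QP u u' k uL u'L.
  by rewrite /near equ adju k1 !andbF.
exists (c1 ++ c2 ++ c); split; last 2 first.
- by move=> p pc; rewrite !mem_cat pc !orbT.
- exists a, a', b; split=> // p pL; exists (Q p.1); split.
    apply: (@maps_mem _ (Q p.1, act a p.1)).
    by rewrite mem_cat (map_f (fun p => (Q p.1, act a p.1)) pL).
  apply: (@maps_mem _ (act b (Q p.1), act a' p.2)).
  by rewrite !mem_cat (map_f (fun p => (act b (Q p.1), act a' p.2)) pL) orbT.
have mem1 p : p \in L -> p.1 \in map fst L by apply: map_f.
have mem2 p : p \in L -> p.2 \in map snd L by apply: map_f.
apply: condition_cat; last 2 first.
- apply: condition_cat => // [|_ q /mapP[p pL ->] qc]; last first.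
    apply: compat_far => s Ss /=; split; last first.
      by apply: a'N; rewrite ?mem2 // mem_cat map_f.
    by rewrite near_actV -actM; apply: QF; rewrite ?mem1 // map_f.
  move=> _ _ /mapP[p pL ->] /mapP[q qL ->]; apply: compat_far1 => /=.
  + rewrite !act_eq !(ra_adj rich).
    have [] := QP p.1 q.1 1 (mem1 _ pL) (mem1 _ qL).
    by rewrite act1 eqxx !andbT => -> ->; apply: isoL.
  + move=> s Ss s1; split; last by apply: a'S; rewrite ?mem2.
    rewrite near_actV -!actM; apply: QS; rewrite ?mem1 //.
    by rewrite -mulgA -conjgE conjg_eq1.
- move=> _ q /mapP[p pL ->]; rewrite mem_cat.
  case/orP => [/mapP[r rL ->]|qc]; apply: compat_far => s Ss /=; split.
  + by rewrite -actM; apply: QS; rewrite ?mem1 ?Sb.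
  + rewrite near_sym near_actV; apply: a'N; rewrite ?mem2 //; first exact: SV.
    by rewrite mem_cat map_f ?orbT // mem1.
  + by apply: QF; rewrite ?mem1 // map_f.
  + by apply: aN; rewrite ?mem1 // map_f.
- move=> _ _ /mapP[p pL ->] /mapP[q qL ->]; apply: compat_far1 => /=.
    have [] := QP p.1 q.1 1 (mem1 _ pL) (mem1 _ qL).
    by rewrite act1 eqxx !andbT act_eq (ra_adj rich) => -> ->.
  by move=> s Ss s1; split; [apply: QS | apply: aS]; rewrite ?mem1.
Qed.

(** The union of a generic chain of conditions is the graph of [w]: totality, surjectivity,
    realization of each finite partial isomorphism and fixing each finite pattern in an orbit are
    all dense. *)
Lemma generic_automorphism : enumerable Gamma -> enumerable X ->
  exists w w' : X -> X,
  [/\ cancel w w' /\ cancel w' w,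
      forall s x, S s -> w (act s x) = act s (w x),
      forall x y, adj (w x) (w y) = adj x y,
      forall L, partial_iso L -> exists a a' b, [/\ A a, A a', B b &
        forall p, p \in L -> act b (w' (act a p.1)) = w' (act a' p.2)]
    & forall K : seq Gamma, exists z, forall k, k \in K ->
        w (act k z) = act k z].
Proof.
move=> enumG enumX; have [eX eXP] := enumX.
have [eL eLP] := enumerable_seq (enumerable_prod enumX enumX).
have [eK eKP] := enumerable_seq enumG.
pose D n c := [/\ exists y, maps c (eX n) y, exists x, maps c x (eX n),
  partial_iso (eL n) -> realizes c (eL n)
  & exists z, forall k, k \in eK n -> maps c (act k z) (act k z)].
have dense n c : condition c ->
    exists c', [/\ condition c', {subset c <= c'} & D n c'].
  move=> okc; have [c1 [ok1 sub1 [y ydom]]] := dense_dom (eX n) okc.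
  have [c2 [ok2 sub2 [x xcod]]] := dense_cod (eX n) ok1.
  have [c3 [ok3 sub3 real]] : exists c3, [/\ condition c3, {subset c2 <= c3}
      & partial_iso (eL n) -> realizes c3 (eL n)].
    have [isoL|nisoL] := pselect (partial_iso (eL n)); last by exists c2; split.
    by have [c3 [? ? ?]] := dense_realizes ok2 isoL; exists c3.
  have [c4 [ok4 sub4 fixK]] := dense_fix (eK n) ok3.
  have sub24 : {subset c2 <= c4} by move=> p /sub3/sub4.
  have sub14 : {subset c1 <= c4} by move=> p /sub2/sub24.
  exists c4; split=> //; first by move=> p /sub1/sub14.
  split=> //.
  - by exists y; apply: maps_sub ydom.
  - by exists x; apply: maps_sub xcod.
  - move=> /real[a [a' [b [Aa Aa' Bb abP]]]]; exists a, a', b; split=> // p.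
    by move=> /abP[q [m1 m2]]; exists q; split; apply: maps_sub (sub4) _.
have [//|s sP] := generic_sequence (D := D) (c0 := [::]) _ dense.
have mono m n : (m <= n)%N -> {subset s m <= s n}.
  elim: n => [|n IH]; first by rewrite leqn0 => /eqP->.
  rewrite leq_eqVlt => /predU1P[-> //|/IH sub p /sub].
  by have [_ + _] := sP n; apply.
pose G x y := exists n, maps (s n) x y.
have GP x y x' y' : G x y -> G x' y' -> (x == x') = (y == y') /\ adj x x' = adj y y'.
  move=> [m xy] [n xy']; have [ok _ _] := sP (maxn m n).
  by apply: (maps_compat ok); [apply: maps_sub xy | apply: maps_sub xy'];
    apply: mono; rewrite ?leq_maxl ?leq_maxr.
have /choice[w wP] : forall x, exists y, G x y.
  move=> x; have [n <-] := eXP x; have [_ _ [[y xy] _ _ _]] := sP n.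
  by exists y, n.+1.
have /choice[w' w'P] : forall y, exists x, G x y.
  move=> y; have [n <-] := eXP y; have [_ _ [_ [x xy] _ _]] := sP n.
  by exists x, n.+1.
have wE x y : G x y -> w x = y.
  by move=> xy; have [] := GP _ _ _ _ (wP x) xy; rewrite eqxx => /esym/eqP.
have w'E x y : G x y -> w' y = x.
  by move=> xy; have [] := GP _ _ _ _ (w'P y) xy; rewrite eqxx => /eqP.
exists w, w'; split.
- by split=> x; [apply/w'E/wP | apply/wE/w'P].
- move=> t x St; apply: wE; have [n xy] := wP x.
  by exists n; apply: maps_act.
- by move=> x y; have [] := GP _ _ _ _ (wP x) (wP y).
- move=> L; have [n <-] := eLP L => isoL.
  have [_ _ [_ _ /(_ isoL) [a [a' [b [Aa Aa' Bb abP]]]] _]] := sP n.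
  exists a, a', b; split=> // p /abP[q [m1 m2]].
  by rewrite (w'E q) ?(w'E (act b q)) //; exists n.+1.
- move=> K; have [n <-] := eKP K; have [_ _ [_ _ _ [z zP]]] := sP n.
  by exists z => k kK; apply: wE; exists n.+1; apply: zP.
Qed.

End Conditions.

(** * Twisting an action along an edge orbit of a tree *)

Section Walks.
Variable T : graph.
Implicit Types (x y z : vertex T) (e f : edge T) (p q : seq (edge T)).

Lemma rng_bar e : rng (bar e) = src e.
Proof. by rewrite -src_bar barK. Qed.

Lemma is_walk_cat x p q z :
  is_walk x (p ++ q) z <-> exists2 y, is_walk x p y & is_walk y q z.
Proof.
elim: p x => [|e p IH] x /=; first by split=> [|[_ <-]//]; exists x.
split=> [[ex /IH[y ? ?]]|[y [ex pw] qw]]; first by exists y.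
by split=> //; apply/IH; exists y.
Qed.

Lemma is_walk_rev x p y : is_walk x p y -> is_walk y (rev (map (@bar T) p)) x.
Proof.
elim: p x => [|e p IH] x /=; first by move->.
move=> [<- /IH pw]; rewrite rev_cons -cats1; apply/is_walk_cat.
by exists (rng e); rewrite //= src_bar rng_bar.
Qed.

Lemma not_sorted_cat (A : Type) (r : rel A) (s : seq A) : ~~ sorted r s ->
  exists s1 u v s2, s = s1 ++ u :: v :: s2 /\ ~~ r u v.
Proof.
elim: s => // u [|v s] IH //=.
have [ruv /= /IH[s1 [u' [v' [s2 [-> ?]]]]]|nruv _] := boolP (r u v).
  by exists (u :: s1), u', v', s2.
by exists [::], u, v, s.
Qed.

Lemma not_uniq_map_cat (A B : eqType) (h : A -> B) (s : seq A) :
  ~~ uniq (map h s) ->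
  exists s1 u s2 v s3, s = s1 ++ u :: s2 ++ v :: s3 /\ h u = h v.
Proof.
elim: s => // u s IH /=; rewrite negb_and negbK.
case/orP => [/mapP[v vs uv]|/IH[s1 [u' [s2 [v [s3 [-> ?]]]]]]].
  by case/splitPr: vs => s2 s3; exists [::], u, s2, v, s3.
by exists (u :: s1), u', s2, v, s3.
Qed.

(** A non-empty closed walk is not a circuit, so it backtracks or ends two of its edges at the same
    vertex. Deleting the backtrack, or cutting out the closed subwalk, leaves shorter closed
    walks. *)
Lemma closed_walk_ind (P : seq (edge T) -> Prop) : is_tree T ->
  P [::] ->
  (forall p e q, P (p ++ q) -> P (p ++ e :: bar e :: q)) ->
  (forall p q r, P q -> P (p ++ r) -> P (p ++ q ++ r)) ->
  forall x p, is_walk x p x -> P p.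
Proof.
move=> [_ _ no_circuit] P0 Pback Pcat x p.
move: {2}(size p) (leqnn (size p)) x => n; elim: n p => [|n IH] p.
  by rewrite leqn0 size_eq0 => /eqP->.
move=> pn x pw; have [->//|p0] := eqVneq p [::].
have [srt|/not_sorted_cat[p1 [e [f [p2 [pE]]]]]] :=
    boolP (sorted (fun e f => f != bar e) p); last first.
  rewrite negbK => /eqP fE; rewrite {}pE {}fE in pn pw *.
  apply: Pback; apply: (IH _ _ x).
    by rewrite -ltnS (leq_trans _ pn) // !size_cat /= !addnS !ltnS leqnSn.
  move/is_walk_cat: pw => [y pw [ey [_]]]; rewrite rng_bar ey => qw.
  by apply/is_walk_cat; exists y.
have [unq|/not_uniq_map_cat[p1 [e [p2 [f [p3 [pE ef]]]]]]] :=
    boolP (uniq [seq rng e | e <- p]).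
  by case: (no_circuit p); split=> //; [exact/eqP | exists x].
rewrite {}pE in pn pw *; have -> : p1 ++ e :: p2 ++ f :: p3 =
    rcons p1 e ++ rcons p2 f ++ p3 by rewrite -!cats1 -!catA.
move/is_walk_cat: pw => [y pw [ey /is_walk_cat[z qw [fz rw]]]].
rewrite !size_cat /= size_cat /= !addnS !ltnS in pn.
apply: Pcat.
  apply: (IH _ _ (rng e)); last first.
    by rewrite -cats1; apply/is_walk_cat; exists z.
  rewrite size_rcons (leq_trans _ pn) // ltnS addnA addnAC.
  exact: leq_addl.
apply: (IH _ _ x).
  rewrite size_cat size_rcons addSn (leq_trans _ pn) //.
  by rewrite ltnS leq_add2l leq_addl.
apply/is_walk_cat; exists (rng e); last by rewrite ef.
by rewrite -cats1; apply/is_walk_cat; exists y.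
Qed.

End Walks.

(** * Edge twists, holonomy and the twisted action *)

Section Twist.
Variables (Gamma : groupType) (T : graph) (a : graph_action Gamma T).
Hypotheses (T_tree : is_tree T) (a_noinv : without_inversion a).
Variables (X : eqType) (act : Gamma -> X -> X) (adj : rel X).
Hypotheses (act_action : is_action act).
Hypothesis act_adj : forall g x y, adj (act g x) (act g y) = adj x y.
Variables (e : edge T) (w w' : X -> X).
Hypotheses (wK : cancel w w') (w'K : cancel w' w).
Hypothesis w_act : forall s x, estab a e s -> w (act s x) = act s (w x).
Hypothesis w_adj : forall x y, adj (w x) (w y) = adj x y.

Let act1 x : act 1 x = x. Proof. by have [] := act_action. Qed.
Let actM g h x : act (g * h) x = act g (act h x).
Proof. by have [] := act_action. Qed.
Let actK g : cancel (act g) (act g^-1).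
Proof. by move=> x; rewrite -actM mulVg act1. Qed.
Let actVK g : cancel (act g^-1) (act g).
Proof. by move=> x; rewrite -actM mulgV act1. Qed.
Let eact1 f : eact a 1 f = f. Proof. by have [] := eactP a. Qed.
Let eactM g h f : eact a (g * h) f = eact a g (eact a h f).
Proof. by have [] := eactP a. Qed.
Let vact1 v : vact a 1 v = v. Proof. by have [] := vactP a. Qed.
Let vactM g h v : vact a (g * h) v = vact a g (vact a h v).
Proof. by have [] := vactP a. Qed.

Let w'_act s x : estab a e s -> w' (act s x) = act s (w' x).
Proof. by move=> es; rewrite -{1}(w'K x) -w_act // wK. Qed.

Let w'_adj x y : adj (w' x) (w' y) = adj x y.
Proof. by rewrite -w_adj !w'K. Qed.

(* Crossing [g e] applies [g w g^-1] and crossing its inverse edge applies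
   [g w^-1 g^-1]; [g] only matters modulo the stabilizer of [e], which
   commutes with [w]. *)
Definition twist (f : edge T) (x : X) : X :=
  if pselect (exists g, f = eact a g e) is left H then
    let g := projT1 (cid H) in act g (w (act g^-1 x))
  else if pselect (exists g, f = eact a g (bar e)) is left H then
    let g := projT1 (cid H) in act g (w' (act g^-1 x))
  else x.

Let estab_div g h : eact a g e = eact a h e -> estab a e (h^-1 * g).
Proof.
by rewrite /estab /stabilizer /= eactM => ->; rewrite -eactM mulVg eact1.
Qed.

Lemma twist_pos g x : twist (eact a g e) x = act g (w (act g^-1 x)).
Proof.
rewrite /twist; case: pselect => [H|[]]; last by exists g.
case: cid => h /= /estab_div gh.
have -> : act h^-1 x = act (h^-1 * g) (act g^-1 x) by rewrite actM actVK.
by rewrite w_act // actM actVK.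
Qed.

(** Absence of inversions rules out the first branch of [twist]: no translate of [bar e] is a
    translate of [e]. *)
Lemma twist_neg g x : twist (eact a g (bar e)) x = act g (w' (act g^-1 x)).
Proof.
rewrite /twist; case: pselect => [[h gh]|_].
  case: (a_noinv (g := g^-1 * h) (e := e)).
  by rewrite eactM -gh -eactM mulVg eact1.
case: pselect => [H|[]]; last by exists g.
case: cid => h /= gh.
have {}gh : estab a e (h^-1 * g).
  by apply: estab_div; rewrite -[eact a g e]barK bar_eact gh -bar_eact barK.
have -> : act h^-1 x = act (h^-1 * g) (act g^-1 x) by rewrite actM actVK.
by rewrite w'_act // actM actVK.
Qed.

Lemma twist_case f : [\/ exists g, f = eact a g e,
  exists g, f = eact a g (bar e)
  | [/\ twist f =1 id, twist (bar f) =1 id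
      & forall h, twist (eact a h f) =1 id]].
Proof.
have [?|npos] := pselect (exists g, f = eact a g e); first by constructor 1.
have [?|nneg] := pselect (exists g, f = eact a g (bar e)); first by constructor 2.
constructor 3; split=> [x|x|h x]; rewrite /twist.
- by case: pselect => // _; case: pselect.
- case: pselect => [[g fg]|_].
    by case: nneg; exists g; rewrite -bar_eact -fg barK.
  case: pselect => // -[g fg].
  by case: npos; exists g; rewrite -[f]barK fg bar_eact barK.
- case: pselect => [[g fg]|_].
    by case: npos; exists (h^-1 * g); rewrite eactM -fg -eactM mulVg eact1.
  case: pselect => // -[g fg].
  by case: nneg; exists (h^-1 * g); rewrite eactM -fg -eactM mulVg eact1.
Qed.

Lemma twist_barK f x : twist f (twist (bar f) x) = x.
Proof.
case: (twist_case f) => [[g ->]|[g ->]|[-> ->]//].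
  by rewrite bar_eact twist_pos twist_neg actK w'K actVK.
by rewrite bar_eact barK twist_pos twist_neg actK wK actVK.
Qed.

Lemma twist_act h f x : twist (eact a h f) (act h x) = act h (twist f x).
Proof.
case: (twist_case f) => [[g ->]|[g ->]|[-> _ ->]//].
  by rewrite -eactM !twist_pos invgM !actM actK.
by rewrite -eactM !twist_neg invgM !actM actK.
Qed.

Lemma twist_adj f x y : adj (twist f x) (twist f y) = adj x y.
Proof.
case: (twist_case f) => [[g ->]|[g ->]|[tw _ _]]; last by rewrite !tw.
  by rewrite !twist_pos act_adj w_adj act_adj.
by rewrite !twist_neg act_adj w'_adj act_adj.
Qed.

Definition holonomy (p : seq (edge T)) (x : X) : X := foldr twist x p.

Lemma holonomy_cat p q x : holonomy (p ++ q) x = holonomy p (holonomy q x).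
Proof. exact: foldr_cat. Qed.

(** Backtracks cancel by [twist_barK], and closed subwalks act trivially by induction. *)
Lemma holonomy_closed v p : is_walk v p v -> forall x, holonomy p x = x.
Proof.
apply: (closed_walk_ind (P := fun p => forall x, holonomy p x = x) T_tree) => //.
  by move=> {}p f q IH x; rewrite holonomy_cat /= twist_barK -holonomy_cat.
by move=> {}p q r IHq IH x; rewrite !holonomy_cat IHq -holonomy_cat.
Qed.

Lemma holonomy_eq u v p q x : is_walk u p v -> is_walk u q v ->
  holonomy p x = holonomy q x.
Proof.
move=> pw qw; have rw := is_walk_rev qw.
have qK y : holonomy (rev (map (@bar T) q)) (holonomy q y) = y.
  by rewrite -holonomy_cat (@holonomy_closed v) //; apply/is_walk_cat; exists u.
rewrite -{1}(qK x) -holonomy_cat (@holonomy_closed u) //.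
by apply/is_walk_cat; exists v.
Qed.

Lemma holonomy_act h p x :
  holonomy (map (eact a h) p) (act h x) = act h (holonomy p x).
Proof. by elim: p => //= f p ->; rewrite twist_act. Qed.

Lemma is_walk_act h u p v :
  is_walk u p v -> is_walk (vact a h u) (map (eact a h) p) (vact a h v).
Proof.
elim: p u => [|f p IH] u /=; first by move->.
by move=> [<- /IH pw]; rewrite src_eact rng_eact.
Qed.

Lemma twisted_action : exists pi : Gamma -> X -> X,
  [/\ is_action pi,
      forall g x y, adj (pi g x) (pi g y) = adj x y,
      forall g x, vstab a (src e) g -> pi g x = act g x,
      forall g x, vstab a (rng e) g -> pi g x = w (act g (w' x))
    & forall g, exists K : seq Gamma, forall z,
        (forall k, k \in K -> w (act k z) = act k z) -> pi g z = act g z].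
Proof.
have [_ T_connected _] := T_tree.
have /choice[path pathP] g := T_connected (src e) (vact a g (src e)).
pose pi g x := holonomy (path g) (act g x).
have piE g p x : is_walk (src e) p (vact a g (src e)) ->
    pi g x = holonomy p (act g x) by rewrite /pi => /(holonomy_eq _ (pathP g)) ->.
exists pi; split.
- split=> [x|g h x]; first by rewrite (piE _ [::]) ?vact1 /=.
  (* The path for [g] followed by the [g]-translate of the path for [h] leads to the image under
     [g * h]; this is the cocycle relation. *)
  rewrite (piE _ (path g ++ map (eact a g) (path h))).
    by rewrite holonomy_cat actM holonomy_act.
  apply/is_walk_cat; exists (vact a g (src e)); first exact: pathP.
  by rewrite vactM; apply: is_walk_act; apply: pathP.
- move=> g x y; rewrite -[RHS](act_adj g) /pi.
  by elim: (path g) => //= f p; rewrite twist_adj.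
- by move=> g x ge; rewrite (piE _ [::]) //= ge.
- move=> g x ge; rewrite (piE _ [:: e; eact a g (bar e)]) /=; last first.
    rewrite -!bar_eact src_bar rng_eact ge; split=> //; split=> //.
    by rewrite rng_bar src_eact.
  have {1}-> : e = eact a 1 e by rewrite eact1.
  by rewrite twist_pos twist_neg invg1 !act1 actK.
- move=> g; suff /choice[k kP] : forall f, exists k, forall z,
      w (act k z) = act k z -> twist f (act g z) = act g z.
    exists (map k (path g)) => z wz; rewrite /pi.
    elim: (path g) wz => //= f p IH wz; rewrite IH; last first.
      by move=> h hp; apply: wz; rewrite inE hp orbT.
    by apply: kP; apply: wz; rewrite mem_head.
  move=> f; case: (twist_case f) => [[h ->]|[h ->]|[tw _ _]].
  + exists (h^-1 * g) => z wz.
    by rewrite twist_pos -actM wz actM actVK.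
  + exists (h^-1 * g) => z wz.
    by rewrite twist_neg -actM -{1}wz wK actM actVK.
  + by exists 1 => z _; rewrite tw.
Qed.

End Twist.

Theorem corollaryC (Gamma : groupType) (T : graph) (a : graph_action Gamma T) :
  countable [set: Gamma]%classic ->
  nontrivial_tree T ->
  without_inversion a ->
  (forall v : vertex T, infinite_set (vstab a v)) ->
  (forall e : edge T,
     [/\ finite_set (estab a e),
         highly_core_free (estab a e) (vstab a (src e))
       & highly_core_free (estab a e) (vstab a (rng e))]) ->
  in_HR Gamma.
Proof.
move=> Gcount [Ttree [e]] noinv vinf hcf; split=> //.
have [efin ehcf _] := hcf e; have [esub _ _] := ehcf.
have [adj rich] := ex_rich_action Gcount.
have enumG := enumerable_countable 1 Gcount.
have enumX := enumerable_prod enumG enumerable_nat.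
have [w [w' [[wK w'K] w_act w_adj homog fixK]]] :=
  generic_automorphism rich esub efin (hcf_escapes (vinf _) ehcf) (vinf (rng e))
    enumG enumX.
have [pi [pi_act pi_adj pi_src pi_rng pi_fix]] :=
  twisted_action Ttree noinv (ra_act rich) (ra_adj rich) wK w'K w_act w_adj.
pose X := (Gamma * nat)%type.
have adj_sym (x y : X) : adj x y -> adj y x by rewrite (ra_sym rich).
have adj_irr (x : X) : ~ adj x x.
  by apply/negP; have := ra_orbit rich 1 x; have [-> _] := ra_act rich.
exists (SGraph adj_sym adj_irr), pi; split=> /=.
- split.
    apply: eq_card_nat.
      by rewrite -setXTT; apply: countableX => //; apply: countableP.
    move=> /(finite_image snd) sndX; apply: infinite_nat.
    by apply: sub_finite_set sndX => n _; exists (1, n).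
  move=> U W /finite_seqP[sU ->] /finite_seqP[sW ->] UW0.
  have [z zP] := ra_extension rich sU (sU ++ sW).
  have zE x : x \in sU ++ sW -> z != x /\ adj z x = (x \in sU).
    by have := zP x 1; have [-> _] := ra_act rich; apply.
  exists z; split=> [|u uU|x xW].
  + by move=> zUW; have [|/eqP] := zE z; rewrite ?mem_cat //; apply/orP.
  + by rewrite /= (zE u _).2 // mem_cat uU.
  + rewrite /= (zE x _).2 ?mem_cat ?xW ?orbT // => xU.
    by have : (set0 : set X)%classic x by rewrite -UW0.
- by split=> // g x y; rewrite /= pi_adj.
- move=> g triv; have [K KP] := pi_fix g; have [z zP] := fixK K.
  by apply: (ra_free rich (x := z)); rewrite -KP.
- move=> U W phi /finite_seqP[sU ->] _ phibij phiadj.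
  have phi_inj : {in sU &, injective phi}.
    move=> x y xU yU; case: phibij => _ + _; apply; rewrite inE //.
  have [|g [g' [b [Ag Ag' Bb gP]]]] := homog [seq (u, phi u) | u <- sU].
    move=> _ _ /mapP[x xU ->] /mapP[y yU ->] /=; split.
      by rewrite (inj_in_eq phi_inj).
    by apply/idP/idP => [/(phiadj _ _ xU yU)|/(phiadj _ _ xU yU)].
  have [pi1 piM] := pi_act; have [act1 actM] := ra_act rich.
  (* On the stabilizers of the two ends, [pi] is the old action for [g] and [g'] and its conjugate
     by [w] for [b], so [u] goes to [act g' (phi u)] before [g'^-1] is applied. *)
  exists (g'^-1 * (b * g)) => u uU.
  rewrite !piM (pi_src g) // (pi_rng b) //.
  have /= -> := gP _ (map_f (fun u => (u, phi u)) uU).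
  by rewrite w'K -(pi_src g') // -piM mulVg pi1.
Qed.
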